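(* An arbitrary one-dimensional non-split central extension of the Lie algebra $n_{n,1}$ is isomorphic to one of the following pairwise non-isomorphic $(n+1)$-dimensional Lie algebras (basis $e_1,\dots,e_{n+1}$): the algebra $n_{n+1,1}$; the algebra $Q_{n+1}$ (this one appearing only when $n$ is odd); and the algebras $L_k$, $2\le k\le \lfloor n/2\rfloor$, where $$L_k:\quad [e_i,e_1]=e_{i+1}\ (2\le i\le n),\qquad [e_i,e_{2k+1-i}]=(-1)^i e_{n+1}\ (2\le i\le k).$$
   Context: All algebras are finite-dimensional over $\mathbb{C}$; brackets are antisymmetric, and brackets of basis vectors that are not listed (and do not follow from listed ones by antisymmetry) are zero. $\lfloor\cdot\rfloor$ denotes the integer part. $n_{m,1}$ is the $m$-dimensional Lie algebra with basis $e_1,\dots,e_m$ and $[e_i,e_1]=e_{i+1}$ for $2\le i\le m-1$. $Q_{2m}$ is the $2m$-dimensional Lie algebra with basis $e_1,\dots,e_{2m}$ and $[e_i,e_1]=e_{i+1}$ for $2\le i\le 2m-2$, $[e_i,e_{2m+1-i}]=(-1)^i e_{2m}$ for $2\le i\le m$. For a nilpotent Lie algebra $N$ and a vector space $\mathbb V$, a 2-cocycle is an antisymmetric bilinear map $\psi:N\times N\to\mathbb V$ with $\psi(x,[y,z])+\psi(z,[x,y])+\psi(y,[z,x])=0$. The central extension $N_\psi$ is the space $N\oplus\mathbb V$ with bracket $[x+u,y+v]_\psi=[x,y]+\psi(x,y)$. Its dimension as an extension is $\dim\mathbb V$. Coboundaries are the maps $(x,y)\mapsto f([x,y])$ for linear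 $f:N\to\mathbb V$. Put $\operatorname{Ann}(\psi)=\{x\in N:\psi(x,N)=0\}$ and let $Z(N)$ be the center of $N$. The extension $N_\psi$ is called non-split if $\operatorname{Ann}(\psi)\cap Z(N)=0$ and the cohomology classes of the components $\psi_1,\dots,\psi_s$ of $\psi$ in a basis of $\mathbb V$ ($s=\dim\mathbb V$) are linearly independent modulo coboundaries.
   Formalization: Pairwise non-isomorphism is claimed only for n other than 1 and 3: for n = 1 both n_{2,1} and Q_2 are the abelian plane, and for n = 3 Q_4 is isomorphic to n_{4,1} (exchange e_1 and e_2 up to sign). The classification is stated for all n ≥ 1. *)

(* Defs.v *)
From HB Require Import structures.
From mathcomp Require Import all_boot all_order all_algebra.
From mathcomp Require Import complex reals.
From mathcomp Require Import zify.

Set Implicit Arguments.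
Unset Strict Implicit.
Unset Printing Implicit Defensive.

Import Order.TTheory GRing.Theory Num.Theory.
Local Open Scope ring_scope.

(* Finite-dimensional Lie algebras.  The base field has characteristic zero, so
   antisymmetric means the same as alternating. *)
Record lieAlgebra (F : numFieldType) := LieAlgebra {
  lie_sort :> vectType F;
  lie : {bilinear lie_sort -> lie_sort -> lie_sort};
  lie_antisym : forall x y, lie x y = - lie y x;
  lie_jacobi : forall x y z,
    lie x (lie y z) + lie z (lie x y) + lie y (lie z x) = 0
}.
Arguments lie {F l}.

Definition lie_isomorphic (F : numFieldType) (L M : lieAlgebra F) : Prop :=
  exists f : {linear L -> M},
    bijective f /\ (forall x y, f (lie x y) = lie (f x) (f y)).

Record cocycle (F : numFieldType) (N : lieAlgebra F) (V : vectType F) :=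
  Cocycle {
  cocycle_map :> {bilinear N -> N -> V};
  cocycle_antisym : forall x y, cocycle_map x y = - cocycle_map y x;
  cocycle_cond : forall x y z,
    cocycle_map x (lie y z) + cocycle_map z (lie x y)
      + cocycle_map y (lie z x) = 0
}.

Section CentralExtension.
Variables (F : numFieldType) (N : lieAlgebra F) (V : vectType F).
Variable psi : cocycle N V.

Definition ext_bracket (a b : (N * V)%type) : (N * V)%type :=
  (lie a.1 b.1, psi a.1 b.1).

Lemma ext_bracket_bilinear : bilinear_for *:%R *:%R ext_bracket.
Proof.
split=> c a x y; rewrite /ext_bracket /=; congr pair => /=;
  by rewrite ?linearPl ?linearPr.
Qed.

HB.instance Definition _ :=
  bilinear_isBilinear.Build F (N * V)%type (N * V)%type (N * V)%type
    *:%R *:%R ext_bracket ext_bracket_bilinear.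

Lemma ext_bracket_antisym a b : ext_bracket a b = - ext_bracket b a.
Proof.
by rewrite /ext_bracket lie_antisym cocycle_antisym.
Qed.

Lemma ext_bracket_jacobi a b c :
  ext_bracket a (ext_bracket b c) + ext_bracket c (ext_bracket a b)
    + ext_bracket b (ext_bracket c a) = 0.
Proof.
by congr pair; rewrite /= ?lie_jacobi ?cocycle_cond.
Qed.

Definition central_extension : lieAlgebra F :=
  @LieAlgebra F (N * V)%type ext_bracket ext_bracket_antisym
    ext_bracket_jacobi.

End CentralExtension.

Section NonSplit.
Variables (F : numFieldType) (N : lieAlgebra F).

Definition in_center (x : N) : Prop := forall y : N, lie x y = 0.

Definition in_ann (V : vectType F) (psi : cocycle N V) (x : N) : Prop :=
  forall y, psi x y = 0.

Definition is_coboundary (V : vectType F) (phi : N -> N -> V) : Prop :=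
  exists f : {linear N -> V}, forall x y, phi x y = f (lie x y).

Definition component (V : vectType F) (psi : cocycle N V) (s : nat)
    (X : s.-tuple V) (i : 'I_s) (x y : N) : F := coord X i (psi x y).

Definition classes_independent (s : nat) (phi : 'I_s -> N -> N -> F) : Prop :=
  forall a : 'I_s -> F,
    is_coboundary (V := F^o) (fun x y => \sum_(i < s) a i * phi i x y) ->
    forall i, a i = 0.

Definition non_split (V : vectType F) (psi : cocycle N V) : Prop :=
  (forall x, in_ann psi x -> in_center x -> x = 0) /\
  (exists2 X : (\dim {:V}).-tuple V,
     basis_of {:V} X & classes_independent (component psi X)).

End NonSplit.

(* Lie algebras given by a multiplication table.  Basis vectors are numbered
   from 1, as in e_1, ..., e_d. *)
Section Table.
Variables (F : numFieldType) (d : nat).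

Definition basis_vec (i : nat) : 'rV[F]_d := \row_(j < d) (j.+1 == i)%:R.

(* [t i j] is the value of a listed bracket [e_i, e_j], and 0 if it is not
   listed; no table below lists both [e_i, e_j] and [e_j, e_i], so that the
   full product is [e_i, e_j] = t i j - t j i. *)
Variable t : nat -> nat -> 'rV[F]_d.

Definition table_bracket (u v : 'rV[F]_d) : 'rV[F]_d :=
  \sum_(i < d) \sum_(j < d)
    (u 0 i * v 0 j) *: (t i.+1 j.+1 - t j.+1 i.+1).

Lemma table_bracket_bilinear : bilinear_for *:%R *:%R table_bracket.
Proof.
split=> c a x y; rewrite /table_bracket /= scaler_sumr -big_split /=;
  apply: eq_bigr => i _; rewrite scaler_sumr -big_split /=;
  apply: eq_bigr => j _; rewrite !mxE scalerA -scalerDl.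
- by rewrite mulrDl mulrA.
- by rewrite mulrDr mulrCA.
Qed.

HB.instance Definition _ :=
  bilinear_isBilinear.Build F 'rV[F]_d 'rV[F]_d 'rV[F]_d
    *:%R *:%R table_bracket table_bracket_bilinear.

Lemma table_bracket_antisym u v : table_bracket u v = - table_bracket v u.
Proof.
rewrite /table_bracket exchange_big /= -sumrN; apply: eq_bigr => i _.
rewrite -sumrN; apply: eq_bigr => j _.
by rewrite -scalerN opprB mulrC.
Qed.

Lemma table_bracket_basis i j : (0 < i <= d)%N -> (0 < j <= d)%N ->
  table_bracket (basis_vec i) (basis_vec j) = t i j - t j i.
Proof.
case: i => // i /andP[_ lti]; case: j => // j /andP[_ ltj].
rewrite /table_bracket (bigD1 (Ordinal lti)) //= (bigD1 (Ordinal ltj)) //=.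
rewrite !mxE !eqxx mulr1 scale1r big1 ?addr0 => [|l nl]; last first.
  rewrite !mxE [_ == j.+1]eqSS (_ : (l == j :> nat) = false) ?mulr0 ?scale0r //.
  by apply: contraNF nl => /eqP e; apply/eqP/val_inj.
rewrite big1 ?addr0 // => l nl; rewrite big1 // => m _.
rewrite !mxE [l.+1 == _]eqSS (_ : (l == i :> nat) = false) ?mul0r ?scale0r //.
by apply: contraNF nl => /eqP e; apply/eqP/val_inj.
Qed.

Lemma basis_vec_decomp (u : 'rV[F]_d) :
  u = \sum_(i < d) u 0 i *: basis_vec i.+1.
Proof.
rewrite [LHS]row_sum_delta; apply: eq_bigr => i _; congr (_ *: _).
by apply/rowP => j; rewrite !mxE eqSS.
Qed.

Let J u v w := table_bracket u (table_bracket v w)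
  + table_bracket w (table_bracket u v) + table_bracket v (table_bracket w u).

Lemma table_bracket_jacobi :
  (forall i j l, (0 < i <= d)%N -> (0 < j <= d)%N -> (0 < l <= d)%N ->
     J (basis_vec i) (basis_vec j) (basis_vec l) = 0) ->
  forall u v w, J u v w = 0.
Proof.
move=> J0.
have JC u v w : J u v w = J v w u by rewrite /J addrC addrA.
have JP c u u' v w : J (c *: u + u') v w = c *: J u v w + J u' v w.
  rewrite /J !(linearPl, linearPr) !scalerDr -!addrA; congr (_ + _).
  rewrite addrCA; congr (_ + _); rewrite [RHS]addrCA; congr (_ + _).
  exact: addrCA.
have Jl u v w : (forall i, (0 < i <= d)%N -> J (basis_vec i) v w = 0) ->
    J u v w = 0.
  move=> H; rewrite (basis_vec_decomp u).
  elim/big_rec: _ => [|i x _ IH]; last by rewrite JP IH H ?scaler0 ?addr0 /=.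
  by rewrite /J !(linear0l, linear0r) !addr0.
move=> u v w; apply: (Jl) => i hi; rewrite JC; apply: (Jl) => j hj.
rewrite JC; apply: (Jl) => l hl; rewrite JC; exact: J0.
Qed.

End Table.

(* The table
     [e_i, e_1] = e_{i+1}                (2 <= i <= p),
     [e_i, e_{2k+1-i}] = (-1)^i e_d      (2 <= i <= k)
   in dimension d; the second family is empty if k < 2.  With
   (p, k) = (d-1, 0), (2m-2, m), (n, k) and d = d, 2m, n+1 this is n_{d,1},
   Q_{2m} and L_k respectively. *)
Section FiliformTable.
Variables (F : numFieldType) (d p k : nat).

Definition filiform_table (i j : nat) : 'rV[F]_d :=
  (if (2 <= i <= p)%N && (j == 1)%N then basis_vec F d i.+1 else 0) +
  (if (2 <= i <= k)%N && (i + j == k.*2.+1)%N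
   then (-1) ^+ i *: basis_vec F d d else 0).

Hypotheses (hp : (p <= d.-1)%N) (hkd : (k.*2 <= d)%N) (hkp : (k.*2 <= p.+2)%N).

Let B := table_bracket filiform_table.
Let e := basis_vec F d.
Let c (i j : nat) : F :=
  if (i + j == k.*2.+1)%N then (-1) ^+ i else 0.

Let Bge2 i j : (2 <= i <= d)%N -> (2 <= j <= d)%N -> B (e i) (e j) = c i j *: e d.
Proof.
move=> hi hj; rewrite /B table_bracket_basis; try lia.
rewrite /filiform_table /c.
have -> : (i == 1%N) = false by lia.
have -> : (j == 1%N) = false by lia.
rewrite !andbF !add0r (addnC j i).
case: eqP => [E|_]; last by rewrite !andbF subr0 scale0r.
rewrite !andbT.
have [ik|ik] : (i <= k \/ k < i)%N by lia.
  have -> : (1 < i <= k)%N by lia.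
  have -> : (1 < j <= k)%N = false by lia.
  by rewrite subr0.
have -> : (1 < i <= k)%N = false by lia.
have -> : (1 < j <= k)%N by lia.
rewrite sub0r -scaleNr; congr (_ *: _).
have -> : j = (k.*2.+1 - i)%N by lia.
rewrite -signr_odd -[RHS]signr_odd oddB ?oddS ?odd_double; last by lia.
by case: (odd i); rewrite /= ?expr0 ?expr1 ?opprK.
Qed.

Let B21 i : (2 <= i <= d)%N -> B (e i) (e 1) = if (i <= p)%N then e i.+1 else 0.
Proof.
move=> hi; rewrite /B table_bracket_basis; try lia.
rewrite /filiform_table addn1 (_ : (1 < i <= k)%N && _ = false); last by lia.
by rewrite ltnn /= !addr0 subr0 andbT (_ : (1 < i)%N = true) //; lia.
Qed.

Let Bd i : (2 <= i <= d)%N -> B (e i) (e d) = 0.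
Proof.
move=> hi; rewrite Bge2; try lia.
by rewrite /c (_ : (_ == _) = false) ?scale0r //; lia.
Qed.

Lemma filiform_jacobi u v w :
  B u (B v w) + B w (B u v) + B v (B w u) = 0.
Proof.
have B12 x y : B x y = - B y x by exact: table_bracket_antisym.
have B0 x : B x 0 = 0 by exact: linear0r.
have BN x y : B x (- y) = - B x y by exact: linearNr.
have BZ x a y : B x (a *: y) = a *: B x y by exact: linearZr_LR.
have Bxx x : B x x = 0.
  apply/eqP; have := scaler_eq0 2%:R (B x x).
  by rewrite pnatr_eq0 /= => <-; rewrite scaler_nat mulr2n {1}B12 addNr.
have H1 j l : (2 <= j <= d)%N -> (2 <= l <= d)%N ->
    B (e 1) (B (e j) (e l)) + B (e l) (B (e 1) (e j)) + B (e j) (B (e l) (e 1)) = 0.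
  move=> hj hl; rewrite Bge2 // BZ B12 B21; try lia.
  rewrite ifF ?oppr0 ?scaler0 ?add0r; last by lia.
  rewrite (B12 (e 1)) !B21 // BN.
  have S m n : (2 <= m <= d)%N -> (2 <= n <= d)%N ->
      B (e m) (if (n <= p)%N then e n.+1 else 0) = c m n.+1 *: e d.
    move=> hm hn; case: leqP => hnp; first by rewrite Bge2 //; lia.
    by rewrite B0 /c ifF ?scale0r //; lia.
  rewrite !S // -scaleNr -scalerDl (_ : _ + _ = 0) ?scale0r //.
  rewrite /c !addnS !eqSS (addnC l j); case: eqP => E; last by rewrite oppr0 addr0.
  have -> : l = (k.*2 - j)%N by lia.
  rewrite -signr_odd -[X in _ + X]signr_odd oddB ?odd_double /=; last by lia.
  by rewrite addNr.
apply: table_bracket_jacobi => i j l hi hj hl.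
rewrite -/B -/(e i) -/(e j) -/(e l).
have T m : (0 < m <= d)%N -> m = 1%N \/ (2 <= m <= d)%N by lia.
have [->|hi2] := T _ hi; have [->|hj2] := T _ hj; have [->|hl2] := T _ hl.
- by rewrite !Bxx !B0 !addr0.
- by rewrite Bxx B0 addr0 (B12 _ (e l)) BN addNr.
- by rewrite Bxx B0 addr0 (B12 (e j)) BN addNr.
- exact: H1.
- by rewrite Bxx B0 add0r (B12 (e 1) (e i)) BN addrN.
- by rewrite -(H1 l i) // addrC addrA.
- by rewrite -(H1 i j) // -addrA addrC.
- by rewrite !Bge2 // !BZ !Bd // !scaler0 !addr0.
Qed.

Definition filiform : lieAlgebra F :=
  @LieAlgebra F 'rV[F]_d (table_bracket filiform_table)
    (table_bracket_antisym filiform_table) filiform_jacobi.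

End FiliformTable.

Section NamedAlgebras.
Variable F : numFieldType.

Definition n1_algebra (m : nat) : lieAlgebra F :=
  @filiform F m m.-1 0 (leqnn _) (leq0n _) (leq0n _).

Fact Q_bound1 m : (m.*2 - 2 <= m.*2.-1)%N. Proof. lia. Qed.
Fact Q_bound2 m : (m.*2 <= (m.*2 - 2).+2)%N. Proof. lia. Qed.

(* Q_{2m}, indexed by m. *)
Definition Q_algebra (m : nat) : lieAlgebra F :=
  @filiform F m.*2 (m.*2 - 2) m (Q_bound1 m) (leqnn _) (Q_bound2 m).

Fact L_bound1 n k : (2 <= k <= n./2)%N -> (k.*2 <= n.+1)%N. Proof. lia. Qed.
Fact L_bound2 n k : (2 <= k <= n./2)%N -> (k.*2 <= n.+2)%N. Proof. lia. Qed.

Definition L_algebra (n k : nat) (hk : (2 <= k <= n./2)%N) : lieAlgebra F :=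
  @filiform F n.+1 n k (leqnn n) (L_bound1 hk) (L_bound2 hk).

(* For odd n the algebra Q_{n+1} is [Q_algebra n.+1./2], since n+1 is twice
   (n+1)/2. *)
Inductive listed_index (n : nat) : Type :=
  | Idx_n
  | Idx_Q of odd n
  | Idx_L (k : nat) of (2 <= k <= n./2)%N.

Definition listed (n : nat) (a : listed_index n) : lieAlgebra F :=
  match a with
  | Idx_n => n1_algebra n.+1
  | Idx_Q _ => Q_algebra n.+1./2
  | Idx_L k hk => L_algebra hk
  end.

End NamedAlgebras.

(* Main.v *)
From HB Require Import structures.
Require Import Defs.
From mathcomp Require Import all_boot all_order all_algebra.
From mathcomp Require Import complex reals.
From mathcomp Require Import zify.

(** Why the theorem holds.

    Existence.  Let [M] be a non-split extension of [n_{n,1}] by a line spanned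
    by a central [z], let [D = [., y1]] with [y1] lifting [e_1 + t e_2], and let
    [y] lift [e_2].  Then [y, D y, ..., D^(n-2) y] lift [e_2, ..., e_n], and the
    ideal [P] of elements whose image has no [e_1]-component satisfies
    [[P, P] <= <z>].  As [z] is central, [D] is skew for the bracket on [P], so
    all brackets of the chain are determined by the numbers
    [g(j) = [y, D^j y]], which vanish for [j] even and for [j > n - 2].
    If [j0] is the largest index with [g(j0) <> 0], replacing [y] by
    [y + t D^(2m) y] with [m > 0] does not change [g(j)] for [j > j0 - 2m] and
    adds [2 t g(j0)] to [g(j0 - 2m)]; so all lower [g(j)] can be made zero
    ([eliminate_lower]).  The result is an adapted basis with the table of a
    listed algebra ([adapted_iso]).  Since [e_n] is central, the condition
    [Ann(psi) :&: Z = 0] says that [psi(e_n, e_1)] and [psi(e_n, e_2)] are not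
    both zero.  If [psi(e_n, e_2) <> 0] then [j0 = n - 2], a suitable [t] makes
    [D^(n-1) y] vanish, and [M] is [Q_{n+1}] ([ext_iso_Q]).  Otherwise
    [D^(n-1) y] spans the line, and [M] is [n_{n+1,1}] if [g = 0], and [L_k] with
    [2k = j0 + 3] if not, after rescaling [y] ([ext_iso_n1_L]).

    Non-isomorphism.  The invariant is the set of [j] for which the centralizer
    of the lower central series term [C^j] has codimension at most one.  For
    the largest [j > 0] outside this set one finds [2k - 3] for [L_k] and
    [n - 3] for [Q_{n+1}], and none for [n_{n+1,1}].  These differ for
    different algebras for [n] other than 1 and 3, because [2k - 3] is odd and
    [Q_{n+1}] occurs for odd [n] only. *)

Set Implicit Arguments.
Unset Strict Implicit.
Unset Printing Implicit Defensive.

Import Order.TTheory GRing.Theory Num.Theory.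
Local Open Scope ring_scope.

(** * Antisymmetry and derivations *)

Lemma eq_opp_eq0 (F : numFieldType) (V : lmodType F) (x : V) : x = - x -> x = 0.
Proof.
move=> xN; apply/eqP; have := scaler_eq0 2%:R x.
by rewrite pnatr_eq0 /= => <-; rewrite scaler_nat mulr2n {1}xN addNr.
Qed.

Section LieAlgebra.
Variables (F : numFieldType) (L : lieAlgebra F).
Implicit Types (x y z : L).

Lemma liexx x : lie x x = 0.
Proof. exact/eq_opp_eq0/lie_antisym. Qed.

Lemma lie_derivation x y z : lie (lie x y) z = lie (lie x z) y + lie x (lie y z).
Proof.
have -> : lie (lie x z) y = lie y (lie z x).
  by rewrite lie_antisym (lie_antisym x z) linearNr /= opprK.
rewrite lie_antisym; apply/eqP; rewrite eq_sym -subr_eq0 opprK addrAC.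
by rewrite addrC [lie y _ + _]addrC addrA lie_jacobi.
Qed.

End LieAlgebra.

Lemma alternating_cocycle (F : numFieldType) (N : lieAlgebra F)
    (V : vectType F) (psi : cocycle N V) x : psi x x = 0.
Proof. exact/eq_opp_eq0/cocycle_antisym. Qed.

Lemma basis_vec_out (F : numFieldType) (d i : nat) :
  (d < i)%N -> basis_vec F d i = 0.
Proof.
move=> di; apply/rowP => j; have := ltn_ord j.
by rewrite !mxE; case: eqP => //; lia.
Qed.

Lemma lie_isomorphic_sym (F : numFieldType) (L M : lieAlgebra F) :
  lie_isomorphic L M -> lie_isomorphic M L.
Proof.
case=> f [[g fK gK] fB].
have glin : linear g.
  by move=> c x y; apply: (can_inj fK); rewrite linearP !gK.
pose gL : {linear M -> L} := HB.pack g (GRing.isLinear.Build F M L *:%R g glin).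
exists gL; split; first by exists f.
by move=> x y; apply: (can_inj fK); rewrite fB !gK.
Qed.

(** * Brackets and lower central series of the filiform tables *)

Section FiliformBracket.
Variables (F : numFieldType) (d p k : nat).
Hypotheses (hp : (p <= d.-1)%N) (hkd : (k.*2 <= d)%N) (hkp : (k.*2 <= p.+2)%N).
Let L := filiform F hp hkd hkp.
Let e (i : nat) : L := basis_vec F d i.

Lemma filiform_lie_e1 i : (2 <= i <= d)%N ->
  lie (e i) (e 1) = if (i <= p)%N then e i.+1 else 0.
Proof.
move=> hi; rewrite [LHS]table_bracket_basis; try lia.
rewrite /filiform_table addn1 (_ : (1 < i <= k)%N && _ = false); last by lia.
by rewrite ltnn /= !addr0 subr0 andbT (_ : (1 < i)%N = true) //; lia.
Qed.

Lemma filiform_lie_ge2 i j : (2 <= i <= d)%N -> (2 <= j <= d)%N ->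
  lie (e i) (e j) = if (i + j == k.*2.+1)%N then (-1) ^+ i *: e d else 0.
Proof.
move=> hi hj; rewrite [LHS]table_bracket_basis; try lia.
have [i1 j1] : (i == 1)%N = false /\ (j == 1)%N = false by lia.
rewrite /filiform_table i1 j1.
rewrite !andbF !add0r (addnC j i); case: eqP => [E|_]; last by rewrite !andbF subr0.
rewrite !andbT; case: (leqP i k) => ik.
  by rewrite (_ : (1 < i)%N = true) ?ifF ?subr0 //; lia.
rewrite andbF ifT; last by lia.
rewrite sub0r -scaleNr; congr (_ *: _).
rewrite -signr_odd -[RHS]signr_odd (_ : odd i = ~~ odd j); last by lia.
by case: (odd j); rewrite /= ?expr0 ?expr1 ?opprK.
Qed.

Lemma filiform_lie_sum (u v : L) :
  lie u v = \sum_(i < d) \sum_(j < d) (u 0 i * v 0 j) *: lie (e i.+1) (e j.+1).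
Proof.
rewrite [LHS]/(table_bracket _ _ _); apply: eq_bigr => i _; apply: eq_bigr => j _.
by rewrite [lie _ _]table_bracket_basis ?ltn_ord.
Qed.

(** Bracketing raises the first nonvanishing coordinate, except for [e_1], whose
    brackets start in degree 3.  The alternative [m = 1] is the start of the
    lower central series: no bracket at all involves [e_1] or [e_2]. *)
Lemma filiform_lie_coord0 (u v : L) (r : 'I_d) (m : nat) :
  (r < m.+1)%N -> (0 < m)%N ->
  (m = 1%N \/ forall i : 'I_d, (i < m)%N -> u 0 i = 0) ->
  (lie u v : 'rV_d) 0 r = 0.
Proof.
move=> rm m0 Hm; rewrite filiform_lie_sum summxE big1 // => i _.
rewrite summxE big1 // => j _; rewrite mxE.
have Ee l : (l > r.+1)%N -> (e l : 'rV_d) 0 r = 0.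
  by move=> h; rewrite mxE (_ : _ == _ = false) //; lia.
have ge2 (l : 'I_d) : (0 < l)%N -> (2 <= l.+1 <= d)%N.
  by have := ltn_ord l; lia.
have [iz|iz] := posnP i; have [jz|jz] := posnP j.
- by rewrite iz jz liexx mxE mulr0.
- rewrite iz lie_antisym filiform_lie_e1 ?ge2 // mxE.
  case: Hm => [m1|Hm]; last by rewrite Hm ?mul0r // iz.
  by case: ifP => _; rewrite ?Ee ?mxE ?oppr0 ?mulr0 //; lia.
- rewrite jz filiform_lie_e1 ?ge2 //.
  case: (ltnP i m) => im.
    case: Hm => [m1|Hm]; [lia | by rewrite Hm ?mul0r].
  by case: ifP => _; rewrite ?Ee ?mxE ?mulr0 //; lia.
- rewrite filiform_lie_ge2 ?ge2 //.
  case: eqP => [E|_]; last by rewrite mxE mulr0.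
  case: (ltnP i m) => im.
    case: Hm => [m1|Hm]; [lia | by rewrite Hm ?mul0r].
  by rewrite mxE Ee ?mulr0 //; lia.
Qed.

(** Left-normed brackets of [j.+1] elements span [C^j], so this says
    [C^j <= <e_{j+2}, ..., e_d>]; coordinates are numbered from 0. *)
Lemma filiform_lcs_coord0 (u : L) (vs : seq L) (r : 'I_d) :
  (0 < size vs)%N -> (r < (size vs).+1)%N ->
  (foldl lie u vs : 'rV_d) 0 r = 0.
Proof.
elim/last_ind: vs r => // vs v IH r _; rewrite size_rcons foldl_rcons => hr.
apply: (@filiform_lie_coord0 _ _ _ (size vs).+1) => //.
case: (posnP (size vs)) => [->|s0]; first by left.
by right=> i hi; apply: IH.
Qed.

End FiliformBracket.

(** * The invariant: centralizers of the lower central series *)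

Section Invariant.
Variable F : numFieldType.

(** The centralizer of [C^j] has codimension at most one iff it meets every pair
    of vectors in a nontrivial combination; this form needs neither subspaces
    nor dimensions and visibly transports along isomorphisms. *)
Definition lcs_centralizer_codim_le1 (L : lieAlgebra F) (j : nat) : Prop :=
  forall x y : L, exists a b : F, (a != 0) || (b != 0) /\
    forall u vs, size vs = j -> lie (a *: x + b *: y) (foldl lie u vs) = 0.

Lemma lcs_centralizer_codim_le1_iso (L M : lieAlgebra F) j :
  lie_isomorphic L M -> lcs_centralizer_codim_le1 L j ->
  lcs_centralizer_codim_le1 M j.
Proof.
move=> [f [[g fK gK] fB]] HL x y; have [a [b [nz H]]] := HL (g x) (g y).
exists a, b; split=> // u vs svs.
have fF (vs' : seq L) u' : f (foldl lie u' vs') = foldl lie (f u') (map f vs').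
  by elim: vs' u' => //= v vs' IH u'; rewrite IH fB.
have := congr1 f (H (g u) (map g vs) _); rewrite size_map => /(_ svs).
by rewrite fB fF linearD !linearZ linear0 /= !gK -map_comp (eq_map gK) map_id.
Qed.

Section FiliformInvariant.
Variables (d p k : nat).
Hypotheses (hp : (p <= d.-1)%N) (hkd : (k.*2 <= d)%N) (hkp : (k.*2 <= p.+2)%N).
Let L := filiform F hp hkd hkp.
Let e (i : nat) : L := basis_vec F d i.

(** Elements without [e_1]-component centralize [C^j]: a bracket
    [[e_i, e_{2k+1-i}]] with [i >= 2] needs an index at most [2k - 1], below
    those occurring in [C^j]. *)
Lemma filiform_codim_le1 j : (0 < j)%N -> (k.*2 < j + 3)%N ->
  lcs_centralizer_codim_le1 L j.
Proof.
move=> j0 hj x y.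
have [a [b [nz ab]]] : exists a b : F, (a != 0) || (b != 0) /\
    forall i : 'I_d, i = 0%N :> nat -> (a *: x + b *: y) 0 i = 0.
  case: (posnP d) => [d0|dpos].
    by exists 1, 0; rewrite oner_neq0; split=> // i; have := ltn_ord i; lia.
  pose o := Ordinal dpos.
  have io (i : 'I_d) : i = 0%N :> nat -> i = o by move=> i0; apply/val_inj.
  case: (eqVneq (x 0 o) 0) => [x0|x0].
    by exists 1, 0; rewrite oner_neq0; split=> // i /io ->; rewrite scale1r scale0r addr0.
  exists (- y 0 o), (x 0 o); rewrite x0 orbT; split=> // i /io ->.
  by rewrite !mxE mulNr mulrC addNr.
exists a, b; split=> // u vs svs.
rewrite filiform_lie_sum big1 // => i _; rewrite big1 // => l _.
have [i0|i0] := posnP i; first by rewrite ab // mul0r scale0r.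
have [lj|lj] := ltnP l j.+1.
  by rewrite filiform_lcs_coord0 ?svs // mulr0 scale0r.
have [hi hl] := (ltn_ord i, ltn_ord l).
rewrite filiform_lie_ge2; try lia.
by rewrite ifF ?scaler0 //; lia.
Qed.

Lemma filiform_foldl_e1 i j : (2 <= i)%N -> (i + j <= d)%N -> (i + j <= p.+1)%N ->
  foldl lie (e i) (nseq j (e 1)) = e (i + j).
Proof.
elim: j i => [|j IH] i i2 hd hij /=; first by rewrite addn0.
by rewrite filiform_lie_e1 ?ifT ?IH ?addSnnS //; lia.
Qed.

(** No nonzero combination of [e_1] and [e_2] centralizes [C^j]: [C^j] contains
    [e_{j+2}], which does not commute with [e_1] modulo [e_d], and [e_{2k-1}],
    which does not commute with [e_2]. *)
Lemma filiform_codim_gt1 j :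
  (j.+2 < k.*2)%N -> (j.+2 <= p)%N -> (j.+3 < d)%N ->
  ~ lcs_centralizer_codim_le1 L j.
Proof.
move=> jk jp jd /(_ (e 1) (e 2)) [a [b [nz H]]].
have ej i : (0 < i <= d)%N -> exists2 r : 'I_d,
    forall l, (e l : 'rV_d) 0 r = (l == i)%:R &
    forall c c' (x y : L), (c *: x + c' *: y : 'rV_d) 0 r
      = c * (x : 'rV_d) 0 r + c' * (y : 'rV_d) 0 r.
  move=> hi; have hr : (i.-1 < d)%N by lia.
  exists (Ordinal hr) => [l | c c' x y]; last by rewrite !mxE.
  by rewrite mxE /= prednK ?(eq_sym l) //; lia.
have lieE l : (2 <= l <= d)%N -> lie (a *: e 1 + b *: e 2) (e l) =
    - a *: (if (l <= p)%N then e l.+1 else 0)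
     + b *: (if (2 + l == k.*2.+1)%N then e d else 0).
  move=> hl; rewrite linearDl !linearZl_LR /= (lie_antisym (e 1)).
  rewrite filiform_lie_e1 // filiform_lie_ge2 //; last by lia.
  by rewrite scalerN scaleNr expr2 mulrNN mulr1 scale1r.
have a0 : a = 0.
  have := H (e 2) (nseq j (e 1)); rewrite size_nseq filiform_foldl_e1; try lia.
  move=> /(_ erefl); rewrite lieE; last by lia.
  rewrite ifT; last by lia.
  have [|r er cr] := ej j.+3; first by lia.
  move/(congr1 (fun x : 'rV_d => x 0 r)).
  rewrite cr er eqxx mulr1 (fun_if (fun x : 'rV_d => x 0 r)) er mxE.
  rewrite (_ : (d == j.+3) = false); last by lia.
  by rewrite if_same mulr0 addr0 => /eqP; rewrite oppr_eq0 => /eqP.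
have b0 : b = 0.
  have := H (e (k.*2.-1 - j)) (nseq j (e 1)).
  rewrite size_nseq filiform_foldl_e1; try lia.
  move=> /(_ erefl); rewrite lieE; last by lia.
  rewrite [X in _ + _ *: X]ifT; last by lia.
  have [|r er cr] := ej d; first by lia.
  move/(congr1 (fun x : 'rV_d => x 0 r)).
  by rewrite cr a0 oppr0 mul0r add0r er eqxx mulr1 mxE.
by rewrite a0 b0 eqxx in nz.
Qed.

End FiliformInvariant.

(** The largest [j > 0] for which the centralizer of [C^j] has codimension at
    least two, and 0 if there is none. *)
Definition listed_bound n (a : listed_index n) : nat :=
  match a with Idx_n => 0 | Idx_Q _ => n - 3 | Idx_L k _ => k.*2 - 3 end.

Lemma listed_bound_inj n (a b : listed_index n) : n <> 1%N -> n <> 3%N ->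
  listed_bound a = listed_bound b -> a = b.
Proof.
move=> n1 n3; case: a => [|o|k hk]; case: b => [|o'|k' hk'] //= E; try (exfalso; lia).
- by congr Idx_Q; apply: bool_irrelevance.
- have kk : k = k' by lia.
  by case: k' / kk hk' {E} => hk'; congr Idx_L; apply: bool_irrelevance.
Qed.

Lemma listed_codim_le1 n (a b : listed_index n) : n <> 1%N -> n <> 3%N ->
  (listed_bound a < listed_bound b)%N ->
  lcs_centralizer_codim_le1 (listed F a) (listed_bound b).
Proof.
move=> n1 n3; case: a => [|o|k hk]; case: b => [|o'|k' hk'] //= E;
  try (exfalso; lia); apply: filiform_codim_le1; lia.
Qed.

Lemma listed_codim_gt1 n (b : listed_index n) : n <> 1%N -> n <> 3%N ->
  (0 < listed_bound b)%N -> ~ lcs_centralizer_codim_le1 (listed F b) (listed_bound b).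
Proof.
move=> n1 n3; case: b => [|o'|k' hk'] //= E; apply: filiform_codim_gt1; lia.
Qed.

Lemma listed_pairwise n (a b : listed_index n) : n <> 1%N -> n <> 3%N ->
  a <> b -> ~ lie_isomorphic (listed F a) (listed F b).
Proof.
move=> n1 n3 nab iso.
have sep (a' b' : listed_index n) : lie_isomorphic (listed F a') (listed F b') ->
    ~ (listed_bound a' < listed_bound b')%N.
  move=> i h; apply: (@listed_codim_gt1 _ b' n1 n3); first by lia.
  by apply: lcs_centralizer_codim_le1_iso i _; apply: listed_codim_le1.
case: (ltngtP (listed_bound a) (listed_bound b)) => [h|h|h].
- exact: sep iso h.
- exact: sep (lie_isomorphic_sym iso) h.
- exact/nab/listed_bound_inj.
Qed.

End Invariant.

(** * Chains of iterated brackets and adapted bases *)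

Lemma linear_inj_bij (F : fieldType) (U V : vectType F) (f : {linear U -> V}) :
  injective f -> \dim {:U} = \dim {:V} -> bijective f.
Proof.
move=> injf dUV; pose g := linfun f; have gE x : g x = f x by rewrite lfunE.
have kg : lker g == 0%VS by apply/lker0P => x y; rewrite !gE; apply: injf.
have img : limg g = fullv.
  apply/eqP; rewrite eqEdim subvf /= limg_dim_eq ?dUV //.
  by rewrite (eqP kg) capv0.
exists (g^-1)%VF => x; first by rewrite -gE lker0_lfunK.
by rewrite -gE limg_lfunVK // img memvf.
Qed.

Section Chains.
Variables (F : numFieldType) (L : lieAlgebra F) (y1 : L).
Let D (x : L) : L := lie x y1.

Lemma iter_lieD m x y : iter m D (x + y) = iter m D x + iter m D y.
Proof. by elim: m => //= m ->; rewrite /D linearDl. Qed.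

Lemma iter_lieZ m c x : iter m D (c *: x) = c *: iter m D x.
Proof. by elim: m => //= m ->; rewrite /D linearZl_LR. Qed.

Lemma iter_lie0 m : iter m D 0 = 0.
Proof. by elim: m => //= m ->; rewrite /D linear0l. Qed.

Lemma iter_lie_sum m (I : Type) (s : seq I) (G : I -> L) :
  iter m D (\sum_(i <- s) G i) = \sum_(i <- s) iter m D (G i).
Proof. exact: (big_morph (iter m D) (iter_lieD m) (iter_lie0 m)). Qed.

(** Modulo [U] the vectors [y, D y, ..., D^r y] form a Jordan chain, hence are
    independent: applying [D^(r - i)] to a relation whose first nonzero
    coefficient is the [i]-th one leaves only that coefficient times
    [D^r y]. *)
Lemma chain_free (U : {vspace L}) r y (c : nat -> F) :
  (forall x, x \in U -> D x \in U) ->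
  iter r D y \notin U -> iter r.+1 D y \in U ->
  \sum_(i < r.+1) c i *: iter i D y \in U -> forall i, (i <= r)%N -> c i = 0.
Proof.
move=> UD yr yr1 sU; elim/ltn_ind => i IH ir.
have UDm m x : x \in U -> iter m D x \in U by elim: m => //= m IHm /IHm /UD.
have := UDm (r - i)%N _ sU; rewrite iter_lie_sum.
have ir1 : (i < r.+1)%N by [].
rewrite (bigD1 (Ordinal ir1)) //= rpredDr.
  by rewrite iter_lieZ -iterD subnK // rpredZeq (negPf yr) orbF => /eqP.
apply: rpred_sum => l li; rewrite iter_lieZ -iterD.
have {}li : nat_of_ord l <> i by move=> E; case/eqP: li; apply/val_inj.
case: (ltngtP l i) => // il; first by rewrite IH ?scale0r ?mem0v //; lia.
apply: rpredZ; rewrite (_ : (r - i + l = (l - i).-1 + r.+1)%N); last by lia.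
by rewrite iterD; apply: UDm.
Qed.

(** [P] plays the role of the ideal spanned by [e_2, ..., e_d], and [z] that of
    the central basis vector [e_d]. *)
Section AdaptedBasis.
Variables (P : {vspace L}) (z : L).
Hypothesis PD : forall x, x \in P -> D x \in P.
Hypothesis PP : forall x x', x \in P -> x' \in P -> lie x x' \in <[z]>%VS.
Hypothesis zC : forall x, lie z x = 0.

Let lineC w x : w \in <[z]>%VS -> lie w x = 0.
Proof. by case/vlineP=> c ->; rewrite linearZl_LR /= zC scaler0. Qed.

Let iterP m x : x \in P -> iter m D x \in P.
Proof. by move=> Px; elim: m => //= m /PD. Qed.

(** [D] is a derivation and kills [[x, x']], which is a multiple of [z]. *)
Lemma lie_skew x x' : x \in P -> x' \in P -> lie (D x) x' = - lie x (D x').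
Proof.
move=> Px Px'; apply/eqP; rewrite -addr_eq0 /D; apply/eqP.
by have := lie_derivation x x' y1; rewrite lineC ?PP.
Qed.

Lemma lie_iter_skew a b x : x \in P ->
  lie (iter a D x) (iter b D x) = (-1) ^+ a *: lie x (iter (a + b) D x).
Proof.
move=> Px; elim: a b => [|a IH] b; first by rewrite scale1r.
by rewrite /= lie_skew ?iterP // -iterS IH exprS mulN1r scaleNr addnS.
Qed.

(** Moving half of the [D]s to the left gives a bracket of the form
    [[u, u]]. *)
Lemma lie_iter_even j x : x \in P -> ~~ odd j -> lie x (iter j D x) = 0.
Proof.
move=> Px oj; have := @lie_iter_skew j./2 j./2 x Px.
rewrite liexx addnn even_halfK // => /esym/eqP.
by rewrite scaler_eq0 signr_eq0 => /eqP.
Qed.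

(** The values [[y, D^j y]] with [j < j0] are removed one at a time, for
    decreasing [j = j0 - 2m], by adding a multiple of [D^(2m) y] to [y].  The
    correction is written [D w] so that [D^r] of the new vector agrees with
    [D^r y] modulo [D^(r+1) P]. *)
Lemma eliminate_lower y j0 : y \in P ->
  (forall j, (j0 < j)%N -> lie y (iter j D y) = 0) ->
  lie y (iter j0 D y) != 0 ->
  exists2 w, w \in P & forall j, lie (y + D w) (iter j D (y + D w)) =
    if j == j0 then lie y (iter j0 D y) else 0.
Proof.
move=> Py y0 nz.
have oj0 : odd j0 by apply: contraNT nz => /lie_iter_even ->.
suff H m : exists2 w, w \in P & forall j,
    (j == j0) || (j0 < j + m.*2)%N ->
    lie (y + D w) (iter j D (y + D w)) = if j == j0 then lie y (iter j0 D y) else 0.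
  by have [w Pw wE] := H j0.+1; exists w => // j; apply: wE; lia.
elim: m => [|m [w Pw wE]].
  exists 0; rewrite ?mem0v // => j; rewrite addn0 (iter_lie0 1 : D 0 = 0) addr0.
  by case: eqP => [->|_] //= /y0.
case: (posnP m) => [m0|m0].
  exists w => // j hj; have [hj'|hj'] := boolP ((j == j0) || (j0 < j + m.*2)%N).
    exact: wE.
  have -> : (j == j0) = false by lia.
  by apply: lie_iter_even; [rewrite rpredD // PD | lia].
set x := y + D w in wE; have Px : x \in P by rewrite rpredD // PD.
have gE : lie x (iter j0 D x) = lie y (iter j0 D y) by rewrite wE eqxx.
have /vlineP[c0 c0E] : lie y (iter j0 D y) \in <[z]>%VS by apply: PP; rewrite // iterP.
have /vlineP[c cE] := PP Px (iterP (j0 - m.*2) Px).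
have c0nz : c0 != 0 by apply: contraNneq nz => c00; rewrite c0E c00 scale0r.
(* With [g i = [x, D^i x]], the value at [i] for [x + t D^(2m) x] is
   [g i + 2 t g (i + 2m) + t^2 g (i + 4m)]; this [t] solves it at
   [i = j0 - 2m], where the last term vanishes. *)
pose t := - c / (2 * c0).
pose w' : L := w + t *: iter m.*2.-1 D x.
exists w'.
  by rewrite rpredD // rpredZ // iterP.
move=> j hj.
have xE : y + D w' = x + t *: iter m.*2 D x.
  rewrite /w' /x /D linearDl linearZl_LR -/(D _) -/(D _) -iterS prednK ?addrA //.
  by rewrite double_gt0.
rewrite xE; clear xE; clearbody w' x.
rewrite iter_lieD iter_lieZ -iterD linearDl !linearDr !linearZl_LR !linearZr_LR /=.
rewrite !lie_iter_skew // -signr_odd odd_double scale1r.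
have S i : (j0 < i + m.*2)%N -> lie x (iter i D x) = (if i == j0 then c0 else 0) *: z.
  by move=> hi; rewrite wE ?hi ?orbT // c0E; case: ifP; rewrite ?scale0r.
rewrite (addnC j m.*2) (S (m.*2 + (m.*2 + j))%N) ?(S (m.*2 + j)%N); try lia.
have -> : (m.*2 + (m.*2 + j) == j0)%N = false by lia.
rewrite c0E scale0r !scaler0 addr0.
have [jm|jm] := eqVneq (m.*2 + j)%N j0.
  rewrite (_ : (j == j0) = false); last by lia.
  rewrite (_ : j = j0 - m.*2)%N ?cE; last by lia.
  rewrite !scalerA -!scalerDl /t (_ : _ + _ = 0) ?scale0r //.
  by rewrite invfM mulrA mulfVK // -addrA -splitr addrN.
rewrite scale0r !scaler0 !addr0.
have [hj'|hj'] := boolP ((j == j0) || (j0 < j + m.*2)%N); first by rewrite wE // c0E.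
have -> : (j == j0) = false by lia.
by apply: lie_iter_even; [| lia].
Qed.

(** The vectors [y1, y, D y, ..., D^r y, zz] form a basis with the filiform
    table: they are independent because [y1] is outside [P], the chain is free
    modulo [<z>], and [zz] spans [<z>].  Only the brackets [[y, D^j y]] need to
    be known, the others following by skewness of [D]. *)
Lemma adapted_iso r d p k (hp : (p <= d.-1)%N) (hkd : (k.*2 <= d)%N)
    (hkp : (k.*2 <= p.+2)%N) y zz : d = r.+3 ->
  \dim {:L} = r.+3 -> y1 \notin P -> y \in P -> z \in P ->
  iter r D y \notin <[z]>%VS -> zz \in <[z]>%VS -> zz != 0 ->
  (r < p)%N ->
  iter r.+1 D y = (if p == r.+2 then zz else 0) ->
  (forall j, lie y (iter j D y) = if (j + 4 == k.*2.+1)%N then zz else 0) ->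
  lie_isomorphic (filiform F hp hkd hkp) L.
Proof.
move=> dr; subst d => dL nPy1 Py Pz yr zzz zz0 rp yr1 yj.
pose Y i := if i == 1%N then y1 else if (i <= r.+2)%N then iter (i - 2) D y else zz.
have Dzz x : x \in <[z]>%VS -> D x \in <[z]>%VS by move=> zx; rewrite /D lineC ?mem0v.
have Pzz : zz \in P by case/vlineP: zzz => c ->; rewrite rpredZ.
pose f (u : filiform F hp hkd hkp) : L := \sum_(i < r.+3) (u : 'rV_r.+3) 0 i *: Y i.+1.
have flin : linear f.
  move=> c u v; rewrite /f scaler_sumr -big_split /=; apply: eq_bigr => i _.
  by rewrite !mxE scalerDl scalerA.
pose fL : {linear filiform F hp hkd hkp -> L} :=
  HB.pack f (GRing.isLinear.Build F _ _ *:%R f flin).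
have f0 u : f u = 0 -> u = 0.
  rewrite /f => fu.
  pose c i := (u : 'rV_r.+3) 0 (inord i).
  have {}fu : \sum_(0 <= i < r.+3) c i *: Y i.+1 = 0.
    by rewrite big_mkord -[RHS]fu; apply: eq_bigr => i _; rewrite /c inord_val.
  suff c0 : forall i, (i < r.+3)%N -> c i = 0.
    by apply/rowP => i; rewrite mxE -(c0 i) // /c inord_val.
  move: fu; rewrite big_nat_recr // big_nat_recl //= big_mkord.
  rewrite {1}/Y eqxx {2}/Y /= ltnn => fu.
  have SP : \sum_(i < r.+1) c i.+1 *: Y i.+2 \in P.
    by apply: rpred_sum => i _; rewrite rpredZ // /Y /= ifT ?iterP // ltnS.
  have c0 : c 0%N = 0.
    apply/eqP; apply: contraNT nPy1 => c00.
    have : c 0%N *: y1 \in P.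
      have -> : c 0%N *: y1 = - (\sum_(i < r.+1) c i.+1 *: Y i.+2 + c r.+2 *: zz).
        by apply/eqP; rewrite -addr_eq0 addrA fu.
      by rewrite rpredN rpredD // rpredZ.
    by rewrite rpredZeq (negPf c00).
  rewrite c0 scale0r add0r in fu.
  have cS : forall i, (i <= r)%N -> c i.+1 = 0.
    apply: (@chain_free <[z]>%VS r y (fun i => c i.+1)) => //.
      by rewrite yr1; case: ifP => // _; rewrite mem0v.
    have -> : \sum_(i < r.+1) c i.+1 *: iter i D y = - (c r.+2 *: zz).
      apply/eqP; rewrite -addr_eq0 -[X in _ == X]fu; apply/eqP; congr (_ + _).
      by apply: eq_bigr => i _; rewrite /Y /= ifT ?subn2 // ltnS.
    by rewrite rpredN rpredZ.
  case=> [|i] // hi; case: (ltngtP i r.+1) => [||->]; [exact: cS | lia |].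
  apply/eqP; move: fu; rewrite big1 => [/eqP|j _]; last by rewrite cS ?scale0r // -ltnS.
  by rewrite add0r scaler_eq0 (negPf zz0) orbF.
have fe i : (0 < i <= r.+3)%N -> f (basis_vec F r.+3 i) = Y i.
  case: i => // i /= hi; rewrite /f (bigD1 (Ordinal hi)) //= mxE eqxx scale1r.
  rewrite big1 ?addr0 // => j /eqP nj; rewrite mxE.
  by rewrite (_ : _ == _ = false) ?scale0r //; apply/eqP => -[E]; case: nj; apply/val_inj.
have Y2 i : (2 <= i)%N -> lie (Y i) (Y 1) = if (i <= p)%N then Y i.+1 else 0.
  move=> i2; rewrite {2}/Y eqxx -/(D _) /Y.
  have [i1 i1'] : (i == 1)%N = false /\ (i.+1 == 1)%N = false by lia.
  rewrite i1 i1'.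
  case: (leqP i r.+2) => ir; last by rewrite /D lineC // ifF //; lia.
  rewrite -iterS (_ : (i - 2).+1 = (i.+1 - 2))%N; last by lia.
  case: (ltngtP i r.+2) => [ilt||->]; [|lia|].
    by rewrite ifT //; lia.
  rewrite (_ : r.+3 - 2 = r.+1)%N // yr1.
  rewrite (_ : (p == r.+2) = (r.+2 <= p)%N) //; lia.
have YY i j : (2 <= i <= r.+3)%N -> (2 <= j <= r.+3)%N ->
    lie (Y i) (Y j) = if (i + j == k.*2.+1)%N then (-1) ^+ i *: zz else 0.
  move=> hi hj; rewrite /Y.
  have [i1 j1] : (i == 1)%N = false /\ (j == 1)%N = false by lia.
  rewrite i1 j1; case: (leqP i r.+2) => ir; last first.
    by rewrite lineC // ifF //; lia.
  case: (leqP j r.+2) => jr; last first.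
    by rewrite lie_antisym lineC // ifF ?oppr0 //; lia.
  rewrite lie_iter_skew // yj (_ : i - 2 + (j - 2) + 4 = i + j)%N; last by lia.
  case: ifP => _; rewrite ?scaler0 //; congr (_ *: _).
  by rewrite -signr_odd -[RHS]signr_odd oddB ?addbF //; lia.
have fB i j : (i < r.+3)%N -> (j < r.+3)%N ->
    f (lie (basis_vec F r.+3 i.+1 : filiform F hp hkd hkp) (basis_vec F r.+3 j.+1))
    = lie (Y i.+1) (Y j.+1).
  have f00 : f 0 = 0 by apply: (linear0 fL).
  have fN u : f (- u) = - f u by apply: (linearN fL).
  have fZ c u : f (c *: u) = c *: f u by apply: (linearZ_LR fL).
  have E1 l : (0 < l)%N -> (l < r.+3)%N ->
      f (lie (basis_vec F r.+3 l.+1 : filiform F hp hkd hkp) (basis_vec F r.+3 1))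
      = lie (Y l.+1) (Y 1%N).
    move=> l0 lr; rewrite filiform_lie_e1 ?Y2 //; try lia.
    by case: ifP => lp //; rewrite fe //; lia.
  case: i => [|i]; case: j => [|j] hi hj.
  - by rewrite !liexx.
  - by rewrite lie_antisym fN E1 // -lie_antisym.
  - exact: E1.
  - rewrite filiform_lie_ge2 ?YY; try lia.
    by case: ifP => // _; rewrite fZ fe //= /Y /= ltnn.
apply: (ex_intro _ fL); split.
  apply: linear_inj_bij => [u v uv|]; last by rewrite dL dimvf /dim /= mul1n.
  apply/eqP; rewrite -subr_eq0; apply/eqP/f0; rewrite -[f _]/(fL _) linearB /= .
  by apply/eqP; rewrite subr_eq0; apply/eqP.
move=> u v; rewrite filiform_lie_sum linear_sum /f linear_sumlz; apply: eq_bigr => i _.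
rewrite linear_sum linear_sumr; apply: eq_bigr => j _.
by rewrite linearZ linearZl_LR linearZr_LR /= scalerA -fB.
Qed.

End AdaptedBasis.
End Chains.

(** * One-dimensional central extensions of n_{n,1} *)

(** Here [n = r + 2]. *)
Section Extension.
Variables (F : numFieldType) (r : nat).
Let N := n1_algebra F r.+2.
Variables (V : vectType F) (psi : cocycle N V).
Let L := central_extension psi.
Let E (i : nat) : N := basis_vec F r.+2 i.

Lemma e_out : E r.+3 = 0. Proof. exact: basis_vec_out. Qed.

Lemma n1_lie_e1 i : (2 <= i <= r.+2)%N -> lie (E i) (E 1) = E i.+1.
Proof.
move=> hi; rewrite filiform_lie_e1 //; case: ifP => // ir.
by rewrite (_ : i = r.+2) ?e_out //; lia.
Qed.

Lemma n1_lie_abelian (x y : N) :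
  (x : 'rV_r.+2) 0 0 = 0 -> (y : 'rV_r.+2) 0 0 = 0 -> lie x y = 0.
Proof.
move=> x0 y0; rewrite filiform_lie_sum big1 // => i _; rewrite big1 // => j _.
have [i0|i0] := posnP i.
  by rewrite (_ : i = 0) ?x0 ?mul0r ?scale0r //; apply/val_inj.
have [j0|j0] := posnP j.
  by rewrite (_ : j = 0) ?y0 ?mulr0 ?scale0r //; apply/val_inj.
have := ltn_ord i; have := ltn_ord j => hi hj.
rewrite filiform_lie_ge2; try lia.
by rewrite addSn addnS scaler0.
Qed.

Lemma e_coord0 i : (2 <= i)%N -> (E i : 'rV_r.+2) 0 0 = 0.
Proof. by case: i => [|[|i]] // _; rewrite mxE. Qed.

(** Adding a multiple of [e_2] to [e_1] does not change the chain in [n_{n,1}],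
    but it does change [D^(n-1)] of a lift of [e_2] in the extension. *)
Lemma n1_lie_e1t t i : (2 <= i <= r.+2)%N -> lie (E i) (E 1 + t *: E 2) = E i.+1.
Proof.
move=> hi; rewrite linearDr linearZr_LR /= n1_lie_e1 //.
by rewrite n1_lie_abelian ?e_coord0 ?scaler0 ?addr0 //; lia.
Qed.

Let first_coord (x : L) : F^o := (x.1 : 'rV_r.+2) 0 0.
Fact first_coord_linear : linear first_coord.
Proof. by move=> c x y; rewrite /first_coord /= !mxE. Qed.
HB.instance Definition _ :=
  GRing.isLinear.Build F L F^o *:%R first_coord first_coord_linear.
Let P : {vspace L} := lker (linfun first_coord).
Lemma mem_P x : (x \in P) = ((x.1 : 'rV_r.+2) 0 0 == 0).
Proof. by rewrite memv_ker lfunE. Qed.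

Hypothesis dimV : \dim {:V} = 1%N.
Let v := vpick {:V}.

Lemma fullv_line : {:V}%VS = <[v]>%VS.
Proof.
by apply/esym/eqP; rewrite eqEdim subvf dimV dim_vline vpick0 -dimv_eq0 dimV.
Qed.

Let z : L := (0, v).

Lemma mem_line (x : L) : x.1 = 0 -> x \in <[z]>%VS.
Proof.
case: x => x1 x2 /= ->.
have : x2 \in <[v]>%VS by rewrite -fullv_line memvf.
case/vlineP => c ->; apply/vlineP; exists c; by congr pair; rewrite /= ?scaler0.
Qed.

Lemma line_fst (x : L) : x \in <[z]>%VS -> x.1 = 0.
Proof. by case/vlineP => c -> /=; rewrite scaler0. Qed.

Lemma z_central (x : L) : lie z x = 0.
Proof. by rewrite [LHS]/(ext_bracket _ _ _) /ext_bracket /= !linear0l. Qed.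

Lemma lie_PP (x x' : L) : x \in P -> x' \in P -> lie x x' \in <[z]>%VS.
Proof. by rewrite !mem_P => /eqP px /eqP px'; apply: mem_line; apply: n1_lie_abelian. Qed.

Lemma lie_mem_P (x x' : L) : lie x x' \in P.
Proof.
rewrite mem_P; apply/eqP; apply: (@filiform_lie_coord0 F _ _ _ _ _ _ _ _ 0 1) => //.
by left.
Qed.

Section Chain.
Variable t : F.
Let y1 : L := (E 1 + t *: E 2, 0).
Let y : L := (E 2, 0).
Let D (x : L) : L := lie x y1.

Lemma y1_notin_P : y1 \notin P.
Proof. by rewrite mem_P /= !mxE /= mulr0 addr0 oner_eq0. Qed.

Lemma y_mem_P : y \in P. Proof. by rewrite mem_P e_coord0. Qed.

Lemma iter_lie_fst m (x : L) : (iter m D x).1 = foldl lie x.1 (nseq m y1.1).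
Proof. by elim: m x => // m IH x; rewrite iterSr IH. Qed.

Lemma iter_lie_line (x : L) : iter r.+1 D x \in <[z]>%VS.
Proof.
apply: mem_line; rewrite iter_lie_fst; apply/rowP => i.
by rewrite filiform_lcs_coord0 ?mxE ?size_nseq.
Qed.

Lemma iter_lie_y i : (i <= r)%N -> (iter i D y).1 = E i.+2.
Proof.
by elim: i => //= i IH ir; rewrite IH ?n1_lie_e1t //; lia.
Qed.

Lemma lie_iter_y i j : (i <= r)%N -> (j <= r)%N ->
  lie (iter i D y) (iter j D y) = (0, psi (E i.+2) (E j.+2)).
Proof.
move=> ir jr; rewrite [LHS]/(ext_bracket _ _ _) /ext_bracket !iter_lie_y //.
by rewrite n1_lie_abelian // e_coord0.
Qed.

(** The chain still reaches a lift of [e_n] after a modification of [y] as in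
    [eliminate_lower]. *)
Lemma iter_lie_y_notin_line w : iter r D (y + D w) \notin <[z]>%VS.
Proof.
apply/negP; rewrite iter_lieD -iterSr rpredDr ?iter_lie_line // => /line_fst.
rewrite iter_lie_y // => /rowP/(_ ord_max); rewrite !mxE eqxx => /eqP.
by rewrite oner_eq0.
Qed.

Lemma iter_lie_y_last : iter r.+1 D y = (0, psi (E r.+2) (E 1) + t *: psi (E r.+2) (E 2)).
Proof.
have : iter r.+1 D y = (0, (iter r.+1 D y).2).
  by rewrite [LHS]surjective_pairing (line_fst (iter_lie_line _)).
move=> ->; congr pair.
by rewrite /= iter_lie_y // linearDr linearZr_LR.
Qed.

Lemma iter_lie_vanish x : iter r.+2 D x = 0.
Proof.
have /vlineP[c cE] := iter_lie_line x.
by rewrite iterS cE /D linearZl_LR /= z_central scaler0.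
Qed.

Lemma lie_y_iter_eq0 j x : (r < j)%N -> lie x (iter j D y) = 0.
Proof.
move=> rj; rewrite -(subnK rj) lie_antisym.
have /vlineP[c ->] : iter (j - r.+1 + r.+1) D y \in <[z]>%VS.
  by rewrite addnC iterD iter_lie_line.
by rewrite linearZl_LR /= z_central scaler0 oppr0.
Qed.

End Chain.

(** [psi(e_n, e_i) = +- psi(e_2, D^(n+i-4) e_2)], and
    [D^(n-1) e_2 = 0]. *)
Lemma psi_top_eq0 i : (2 < i <= r.+2)%N -> psi (E r.+2) (E i) = 0.
Proof.
move=> hi; have ir : (i - 2 <= r)%N by lia.
have := lie_iter_y 0 (leqnn r) ir.
rewrite (lie_iter_skew (fun x _ => lie_mem_P x _) lie_PP z_central _ _ y_mem_P).
rewrite lie_y_iter_eq0 ?scaler0; last by lia.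
by rewrite (_ : (i - 2).+2 = i) => [[]|]; last lia.
Qed.

Lemma line_scale (x w : V) : x != 0 -> exists c, w = c *: x.
Proof.
move=> x0; have /vlineP[a xE] : x \in <[v]>%VS by rewrite -fullv_line memvf.
have /vlineP[b ->] : w \in <[v]>%VS by rewrite -fullv_line memvf.
exists (b / a); rewrite xE scalerA divfK //.
by apply: contraNneq x0 => a0; rewrite xE a0 scale0r.
Qed.

Lemma dim_ext : \dim {:L} = r.+3.
Proof.
move: dimV; rewrite !dimvf => dV.
by rewrite -[LHS]/(dim 'rV[F]_r.+2 + dim V)%N dV /dim /= mul1n addn1.
Qed.

Lemma z_mem_P : z \in P. Proof. by rewrite mem_P /= mxE. Qed.

Lemma ext_pair_eq0 (w : V) : ((0, w) == 0 :> L) = (w == 0).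
Proof. by apply/eqP/eqP => [[]|->]. Qed.

(** [psi(e_n, e_2) = +- psi(e_2, e_n)] is the value [g(n - 2)], so [n] is odd. *)
Lemma ext_iso_Q m : psi (E r.+2) (E 2) != 0 ->
  odd r /\ (m.*2 = r.+3 -> lie_isomorphic (Q_algebra F m) L).
Proof.
move=> b0; have [c cE] := line_scale (- psi (E r.+2) (E 1)) b0.
(* This choice of [y1] gives [D^(n-1) y = 0], since [e_n] then pairs to zero
   with [e_1 + c e_2]. *)
pose y1 : L := (E 1 + c *: E 2, 0); pose y : L := (E 2, 0).
pose D x : L := lie x y1.
have PD x : x \in P -> D x \in P by rewrite lie_mem_P.
have top : lie y (iter r D y) = (0, - psi (E r.+2) (E 2)).
  by rewrite (@lie_iter_y c 0 r) // -cocycle_antisym.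
have top0 : lie y (iter r D y) != 0 by rewrite top ext_pair_eq0 oppr_eq0.
have or : odd r.
  by apply: contraNT top0 => /(lie_iter_even PD lie_PP z_central y_mem_P) ->.
split=> // mr.
have [w Pw wE] := eliminate_lower PD lie_PP z_central y_mem_P
  (fun j rj => lie_y_iter_eq0 c y rj) top0.
have Py' : y + D w \in P by rewrite rpredD ?y_mem_P ?PD.
apply: (adapted_iso PD lie_PP z_central _ _ _ mr dim_ext (y1_notin_P c) Py' z_mem_P
  (iter_lie_y_notin_line c w) _ top0).
- by apply: mem_line; rewrite top.
- by rewrite mr; lia.
- rewrite iter_lieD -iterSr iter_lie_vanish addr0 iter_lie_y_last -cE addrN ifF //; lia.
- by move=> j; rewrite wE (_ : (j == r) = (j + 4 == m.*2.+1)%N) //; lia.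
Qed.

(** Now [D^(n-1) y <> 0], and the two cases are whether all [[y, D^j y]] vanish
    or not. *)
Lemma ext_iso_n1_L : psi (E r.+2) (E 2) = 0 -> psi (E r.+2) (E 1) != 0 ->
  lie_isomorphic (n1_algebra F r.+3) L \/
  exists k (hk : (2 <= k <= (r.+2)./2)%N), lie_isomorphic (L_algebra F hk) L.
Proof.
move=> b0 a0.
pose y1 : L := (E 1 + 0 *: E 2, 0); pose y : L := (E 2, 0).
pose D x : L := lie x y1.
have PD x : x \in P -> D x \in P by rewrite lie_mem_P.
have last : iter r.+1 D y = (0, psi (E r.+2) (E 1)).
  by rewrite iter_lie_y_last scale0r addr0.
have last0 : iter r.+1 D y != 0 by rewrite last ext_pair_eq0.
pose nz j := lie y (iter j D y) != 0.
have nz_le j : nz j -> (j <= r)%N.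
  by apply: contraTT; rewrite -ltnNge /nz => /(lie_y_iter_eq0 0 y) ->; rewrite eqxx.
case: (boolP [exists j : 'I_r.+1, nz j]) => [/existsP[i0 nzi0]|none]; last first.
  left; apply: (adapted_iso PD lie_PP z_central _ _ _ (erefl _) dim_ext
    (y1_notin_P 0) y_mem_P z_mem_P _ (iter_lie_line 0 y) last0).
  - by have := iter_lie_y_notin_line 0 0; rewrite linear0l addr0.
  - by [].
  - by rewrite eqxx.
  move=> j; rewrite addn4 /=; apply/eqP/negPn/negP => nj.
  have jr : (j < r.+1)%N by rewrite ltnS nz_le.
  by move/existsP: none; apply; exists (Ordinal jr).
right.
have ex : exists j, nz j by exists i0.
case: (ex_maxnP ex nz_le) => j0 nzj0 maxj0.
have oj0 : odd j0.
  by apply: contraNT nzj0 => /(lie_iter_even PD lie_PP z_central y_mem_P) ->.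
have j0r : (j0 < r)%N.
  rewrite ltn_neqAle nz_le // andbT; apply: contraNneq nzj0 => ->.
  by rewrite (@lie_iter_y 0 0 r) // cocycle_antisym b0 oppr0.
have hk : (2 <= (j0 + 3)./2 <= (r.+2)./2)%N by lia.
exists (j0 + 3)./2, hk.
have y0 j : (j0 < j)%N -> lie y (iter j D y) = 0.
  by rewrite ltnNge => h; apply/eqP/negPn/negP => /maxj0 /(negP h).
have [w Pw wE] := eliminate_lower PD lie_PP z_central y_mem_P y0 nzj0.
have /vlineP[a' a'E] := iter_lie_line 0 y.
have /vlineP[c cE] : lie y (iter j0 D y) \in <[z]>%VS.
  by apply: lie_PP; rewrite ?y_mem_P //; elim: (j0) => [|i IH]; rewrite ?y_mem_P ?PD.
have c0 : c != 0 by apply: contraNneq nzj0 => c0; rewrite cE c0 scale0r.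
have a'0 : a' != 0 by apply: contraNneq last0 => a'0; rewrite a'E a'0 scale0r.
(* In [L_k] the values [[y, D^j0 y]] and [D^(n-1) y] are the same basis vector;
   scaling [y] by [s] multiplies them by [s^2] and [s]. *)
pose s := a' / c; have s0 : s != 0 by rewrite mulf_neq0 ?invr_eq0.
pose y' : L := s *: (y + D w).
have Py' : y' \in P by rewrite rpredZ // rpredD ?y_mem_P ?PD.
have last' : iter r.+1 D y' = (s * a') *: z.
  by rewrite iter_lieZ iter_lieD -iterSr iter_lie_vanish addr0 a'E scalerA.
have v0 : z != 0 by apply: contraNneq nzj0 => z0; rewrite cE z0 scaler0.
apply: (adapted_iso PD lie_PP z_central _ _ _ (erefl _) dim_ext (y1_notin_P 0) Py' z_mem_P
  _ (iter_lie_line 0 y') _).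
- by rewrite iter_lieZ rpredZeq negb_or s0 iter_lie_y_notin_line.
- by rewrite last' scaler_eq0 negb_or v0 mulf_neq0.
- by [].
- by rewrite eqxx.
move=> j; rewrite iter_lieZ linearZl_LR linearZr_LR /= wE scalerA.
rewrite (_ : (j == j0) = (j + 4 == ((j0 + 3)./2).*2.+1)%N); last by lia.
case: ifP => _; last by rewrite scaler0.
by rewrite -[RHS]/(iter r.+1 D y') last' cE scalerA -mulrA /s divfK.
Qed.

Lemma ext_iso : (forall x, in_ann psi x -> in_center x -> x = 0) ->
  exists a : listed_index r.+2, lie_isomorphic L (listed F a).
Proof.
move=> ann; have [b0|b0] := eqVneq (psi (E r.+2) (E 2)) 0; last first.
  have odr : odd r.+2 by have [/= ->] := ext_iso_Q 0 b0.
  have [_ Q] := ext_iso_Q (r.+3)./2 b0.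
  exists (Idx_Q odr); apply: lie_isomorphic_sym; apply: Q.
  by move: odr => /=; lia.
have a0 : psi (E r.+2) (E 1) != 0.
  apply/eqP => a0; have : E r.+2 = 0.
    apply: ann => x; rewrite (basis_vec_decomp x) linear_sumr big1 // => i _;
      rewrite linearZr_LR /=; case: i => -[|[|i]] hi /=.
    - by rewrite a0 scaler0.
    - by rewrite b0 scaler0.
    - by rewrite (@psi_top_eq0 i.+3) ?scaler0.
    - by rewrite n1_lie_e1 ?leqnn // e_out scaler0.
    - by rewrite n1_lie_abelian ?e_coord0 ?scaler0.
    - by rewrite n1_lie_abelian ?e_coord0 ?scaler0.
  by move/rowP/(_ ord_max); rewrite !mxE eqxx => /eqP; rewrite oner_eq0.
case: (ext_iso_n1_L b0 a0) => [iso|[k [hk iso]]].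
  by exists (Idx_n _); apply: lie_isomorphic_sym.
by exists (Idx_L hk); apply: lie_isomorphic_sym.
Qed.

End Extension.

(** In dimension one no cocycle is non-split: an alternating map vanishes on a
    line, so the whole algebra lies in its annihilator. *)
Lemma ext_iso_listed (F : numFieldType) (n : nat) (V : vectType F)
    (psi : cocycle (n1_algebra F n) V) : (0 < n)%N -> \dim {:V} = 1%N ->
  (forall x, in_ann psi x -> in_center x -> x = 0) ->
  exists a : listed_index n, lie_isomorphic (central_extension psi) (listed F a).
Proof.
case: n psi => [|[|r]] // psi _ dimV ann; last exact: ext_iso.
have e10 : (basis_vec F 1 1 : n1_algebra F 1) = 0.
  apply: ann => x; rewrite (basis_vec_decomp x) big_ord1 linearZr_LR.
    by rewrite (alternating_cocycle psi) /= scaler0.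
  by rewrite liexx /= scaler0.
by move/rowP/(_ 0): e10; rewrite !mxE => /eqP; rewrite oner_eq0.
Qed.

Theorem theorem3p4 (R : realType) (n : nat) (hn : (0 < n)%N) :
  (forall (V : vectType R[i]) (psi : cocycle (n1_algebra R[i] n) V),
     \dim {:V} = 1%N -> non_split psi ->
     exists a : listed_index n,
       lie_isomorphic (central_extension psi) (listed R[i] a)) /\
  (n <> 1%N -> n <> 3%N ->
   forall a b : listed_index n,
     a <> b -> ~ lie_isomorphic (listed R[i] a) (listed R[i] b)).
Proof.
split=> [V psi dimV [ann _]|n1 n3 a b]; first exact: ext_iso_listed.
exact: listed_pairwise.
Qed.
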